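(* Let $\mathcal{H}$ be a complex separable infinite-dimensional Hilbert space, let $A$ be a non-zero positive bounded operator on $\mathcal{H}$ such that $R(A)$ is closed, and let $T\in\mathcal{B}_{A^{1/2}}(\mathcal{H})$. Then for every $\epsilon>0$ there exists an $A$-normal operator $N$ with $\|N\|_A<\epsilon$ and $AN$ of finite rank such that $\overline{W_A(T+N)}=W_A(T+N)$.
   Context: $\mathcal{B}(\mathcal{H})$ is the algebra of bounded linear operators on $\mathcal{H}$; $A\in\mathcal{B}(\mathcal{H})$ is positive if $\langle Ax,x\rangle\ge 0$ for all $x$. $R(\cdot)$ denotes range. Put $\langle x,y\rangle_A=\langle Ax,y\rangle$ and $\|x\|_A=\langle x,x\rangle_A^{1/2}$. $\mathcal{B}_A(\mathcal{H})=\{T\in\mathcal{B}(\mathcal{H}): R(T^*A)\subseteq R(A)\}$. For $T\in\mathcal{B}_A(\mathcal{H})$, $T^{\sharp_A}$ is the unique $X\in\mathcal{B}(\mathcal{H})$ with $AX=T^*A$ and $R(X)\subseteq\overline{R(A)}$. An operator $N\in\mathcal{B}_A(\mathcal{H})$ is called $A$-normal if $AN^{\sharp_A}N=ANN^{\sharp_A}$. $\mathcal{B}_{A^{1/2}}(\mathcal{H})=\{T\in\mathcal{B}(\mathcal{H}): \exists c>0,\ \|Tx\|_A\le c\|x\|_A\ \forall x\in\mathcal{H}\}$ (it contains $\mathcal{B}_A(\mathcal{H})$). For $T\in\mathcal{B}_{A^{1/2}}(\mathcal{H})$, $\|T\|_A=\sup\{\|Tx\|_A/\|x\|_A: x\in\overline{R(A)},\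 x\ne 0\}$, and the $A$-numerical range is $W_A(T)=\{\langle Tx,x\rangle_A: x\in\mathcal{H},\ \|x\|_A=1\}$. *)

(* Defs.v *)
From HB Require Import structures.
From mathcomp Require Import all_boot all_order all_algebra.
From mathcomp Require Import sesquilinear.
From mathcomp Require Import complex.
From mathcomp Require Import all_classical all_reals all_analysis.
Import Order.TTheory GRing.Theory Num.Theory numFieldNormedType.Exports.

Set Implicit Arguments.
Unset Strict Implicit.
Unset Printing Implicit Defensive.

Local Open Scope classical_set_scope.
Local Open Scope complex_scope.
Local Open Scope ring_scope.

Section FiniteDimension.
Context (K : fieldType) (V : lmodType K).

(* For a linear subspace S this is finite-dimensionality. *)
Definition finite_dimensional (S : set V) : Prop :=
  exists (n : nat) (e : 'I_n -> V),
    forall x, S x -> exists a : 'I_n -> K, x = \sum_(i < n) a i *: e i.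

End FiniteDimension.

Definition separable (T : topologicalType) : Prop :=
  exists2 D : set T, countable D & dense D.

Section Operators.
Context (R : realType) (H : completeNormedModType R[i]).
Variable dot : {dot H for Num.conj}.

Definition bounded_operator (T : {linear H -> H}) : Prop :=
  exists c : R, forall x : H, `|T x| <= c%:C * `|x|.

(* In R[i], [0 <= z] means that z is real and nonnegative. *)
Definition positive_operator (A : {linear H -> H}) : Prop :=
  forall x : H, 0 <= dot (A x) x.

(* S = T^*. The adjoint is a relation, not a function: it exists by the Riesz
   representation theorem and is unique because dot is definite. *)
Definition is_adjoint (T S : {linear H -> H}) : Prop :=
  bounded_operator S /\ forall x y : H, dot (T x) y = dot x (S y).

Variable A : {linear H -> H}.

(* The semi-inner product <x, y>_A = <A x, y>, linear in x like dot. *)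
Definition dotA (x y : H) : R[i] := dot (A x) y.

(* For positive A, <x, x>_A is a nonnegative real, so its real part loses
   nothing. *)
Definition normA (x : H) : R := Num.sqrt (complex.Re (dotA x x)).

Definition B_A (T : {linear H -> H}) : Prop :=
  bounded_operator T /\
  exists2 S : {linear H -> H},
    is_adjoint T S & range (S \o A) `<=` range A.

(* X = T^{sharp_A}, the reduced solution of A X = T^* A; for positive A and T in
   B_A there is exactly one such X. *)
Definition is_sharp (T X : {linear H -> H}) : Prop :=
  bounded_operator X /\
  (exists2 S : {linear H -> H},
     is_adjoint T S & forall x : H, A (X x) = S (A x)) /\
  range X `<=` closure (range A).

Definition A_normal (N : {linear H -> H}) : Prop :=
  B_A N /\
  exists2 X : {linear H -> H},
    is_sharp N X & forall x : H, A (X (N x)) = A (N (X x)).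

Definition B_Ahalf (T : {linear H -> H}) : Prop :=
  bounded_operator T /\
  exists2 c : R, 0 < c & forall x : H, normA (T x) <= c * normA x.

(* Taken in the extended reals, so that it is meaningful without first
   knowing that the set of quotients is bounded. *)
Definition opnormA (T : {linear H -> H}) : \bar R :=
  ereal_sup [set ((normA (T x) / normA x)%:E : \bar R) |
              x in [set x | closure (range A) x /\ x != 0]].

(* R[i]^o is R[i] with its topology as a normed space. *)
Definition num_rangeA (T : {linear H -> H}) : set R[i]^o :=
  [set dotA (T x) x | x in [set x | normA x = 1]].

End Operators.

(* Main.v *)
(* With respect to <x, y>_A the space is a complete semi-inner product space,
   because the range of A is closed.  Call a limit of <T x, x>_A along a weakly
   null filter with |x|_A -> 1 an essential value of T.  The numerical range of B
   is closed as soon as it contains the essential values of B: a limit of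
   <B x_n, x_n>_A with |x_n|_A = 1 is, x0 being a weak limit of the x_n and
   y_n = x_n - x0, a convex combination of the normalised <B x0, x0>_A and of the
   essential value given by y_n / |y_n|_A, and numerical ranges are convex.
   Finite-rank perturbations do not change the essential values.
   So cover the bounded set of essential values of T by finitely many small square
   cells, and choose A-orthonormal vectors e_j in the range of A such that
   <T e_j, e_j>_A is close to the j-th corner lam_j.  The diagonal operator
   N x = sum_j (lam_j - <T e_j, e_j>_A) <x, e_j>_A e_j is small and A-normal, and the
   numerical range of T + N contains every lam_j, hence by convexity every cell. *)

Require Import Defs.
From HB Require Import structures.
From mathcomp Require Import all_boot all_order all_algebra.
From mathcomp Require Import sesquilinear.
From mathcomp Require Import complex.
From mathcomp Require Import all_classical all_reals all_analysis.
From mathcomp Require Import ring lra.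
Import Order.TTheory GRing.Theory Num.Theory numFieldNormedType.Exports.

Set Implicit Arguments.
Unset Strict Implicit.
Unset Printing Implicit Defensive.

Local Open Scope classical_set_scope.
Local Open Scope complex_scope.
Local Open Scope ring_scope.

(** * Semi-inner products: Cauchy-Schwarz and Riesz representation *)

Section SemiInnerProduct.
Context (R : realType) (H : lmodType R[i]).

Record semi_inner_product (q : H -> H -> R[i]) : Prop := SemiInnerProduct {
  sipDl : forall x y z, q (x + y) z = q x z + q y z;
  sipZl : forall a x y, q (a *: x) y = a * q x y;
  sipC : forall x y, q y x = (q x y)^*;
  sip_ge0 : forall x, 0 <= q x x }.

Definition sqnorm (q : H -> H -> R[i]) (x : H) : R := complex.Re (q x x).

(** Sequential completeness for the semi-norm, the limit being determined only up to null vectors.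
    The set [M] allows two uses: the range of [A] under [dot], and the whole space under the form of
    [A]. *)
Definition complete_for (q : H -> H -> R[i]) (M : set H) : Prop :=
  forall u : nat -> H, (forall n, M (u n)) ->
  (forall e : R, 0 < e -> exists n0, forall n m,
     (n0 <= n)%N -> (n0 <= m)%N -> sqnorm q (u n - u m) <= e) ->
  exists2 x, M x &
    forall e : R, 0 < e -> exists n0, forall n, (n0 <= n)%N -> sqnorm q (u n - x) <= e.

Context (q : H -> H -> R[i]) (qP : semi_inner_product q).
Local Notation sq := (sqnorm q).

Lemma sipDr x y z : q x (y + z) = q x y + q x z.
Proof. by rewrite (sipC qP) (sipDl qP) rmorphD /= -!(sipC qP). Qed.

Lemma sipZr a x y : q x (a *: y) = a^* * q x y.
Proof. by rewrite (sipC qP) (sipZl qP) rmorphM /= -(sipC qP). Qed.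

Lemma sipNl x y : q (- x) y = - q x y.
Proof. by rewrite -scaleN1r (sipZl qP) mulN1r. Qed.

Lemma sipNr x y : q x (- y) = - q x y.
Proof. by rewrite -scaleN1r sipZr rmorphN rmorph1 mulN1r. Qed.

Lemma sip0l y : q 0 y = 0.
Proof. by rewrite -(scale0r 0) (sipZl qP) mul0r. Qed.

Lemma sip0r y : q y 0 = 0.
Proof. by rewrite -(scale0r 0) sipZr rmorph0 mul0r. Qed.

Lemma sip_suml (I : Type) (r : seq I) (P : pred I) (f : I -> H) y :
  q (\sum_(i <- r | P i) f i) y = \sum_(i <- r | P i) q (f i) y.
Proof.
by apply: (big_morph (q^~ y)) => [u v|]; [rewrite (sipDl qP)|rewrite sip0l].
Qed.

Lemma sip_sumr (I : Type) (r : seq I) (P : pred I) (f : I -> H) y :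
  q y (\sum_(i <- r | P i) f i) = \sum_(i <- r | P i) q y (f i).
Proof.
by apply: (big_morph (q y)) => [u v|]; [rewrite sipDr|rewrite sip0r].
Qed.

Lemma sip_sqnorm x : q x x = (sq x)%:C.
Proof.
have := sip_ge0 qP x; rewrite /sqnorm lecE /=.
by case: (q x x) => a b /= /andP[/eqP -> _].
Qed.

Lemma sqnorm_ge0 x : 0 <= sq x.
Proof. by have := sip_ge0 qP x; rewrite sip_sqnorm lecR. Qed.

Lemma sqnorm_lincomb (s t : R) x y :
  sq (s%:C *: x + t%:C *: y) =
    s ^+ 2 * sq x + 2 * s * t * complex.Re (q x y) + t ^+ 2 * sq y.
Proof.
rewrite /sqnorm !(sipDl qP) !sipDr !(sipZl qP) !sipZr (sipC qP x y).
rewrite !sip_sqnorm /sqnorm.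
case: (q x y) => a b; rewrite /Num.conj /=; ring.
Qed.

Lemma sqnormZ a x : ((sq (a *: x))%:C = `|a| ^+ 2 * (sq x)%:C)%R.
Proof. by rewrite -!sip_sqnorm (sipZl qP) sipZr mulrA normCK. Qed.

Lemma sqnormZr (s : R) x : sq (s%:C *: x) = s ^+ 2 * sq x.
Proof. by rewrite -[_ *: x]addr0 -(scaler0 _ 0%:C) sqnorm_lincomb sip0r /= ; ring. Qed.

Lemma sqnormD (s : R) x y :
  sq (x + s%:C *: y) = sq x + 2 * s * complex.Re (q x y) + s ^+ 2 * sq y.
Proof. by rewrite -{1}(scale1r x) sqnorm_lincomb expr1n mul1r mulr1. Qed.

Lemma sqnormB x y : sq (x - y) = sq x - 2 * complex.Re (q x y) + sq y.
Proof. by rewrite -scaleN1r -(rmorphN1 (real_complex R)) sqnormD; ring. Qed.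

Lemma sip_Re_cauchy_schwarz x y : (complex.Re (q x y)) ^+ 2 <= sq x * sq y.
Proof.
set r := complex.Re _.
have h s : 0 <= sq x + 2 * s * r + s ^+ 2 * sq y.
  by rewrite -sqnormD sqnorm_ge0.
have [y0|y0] := eqVneq (sq y) 0.
  (* With [sq y = 0] the polynomial in [s] is affine; for [r != 0] this [s] would give it the value
     -1. *)
  have := h (- (sq x + 1) / (2 * r)); rewrite y0.
  have [-> _|r0] := eqVneq r 0; first by rewrite mulr0 expr0n.
  have -> : sq x + 2 * (- (sq x + 1) / (2 * r)) * r
     + (- (sq x + 1) / (2 * r)) ^+ 2 * 0 = -1 by field.
  by rewrite ler0N1.
have := h (- r / sq y).
have -> : sq x + 2 * (- r / sq y) * r + (- r / sq y) ^+ 2 * sq y =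
  (sq x * sq y - r ^+ 2) / sq y by field.
by rewrite pmulr_lge0 ?invr_gt0 ?lt0r ?y0 ?sqnorm_ge0 // subr_ge0.
Qed.

(* The real inequality for [x] and [q x y *: y]. *)
Lemma sip_cauchy_schwarz x y : `|q x y| ^+ 2 <= (sq x * sq y)%:C.
Proof.
set c := q x y.
have [->|c0] := eqVneq c 0.
  by rewrite normr0 expr0n lecR mulr_ge0 ?sqnorm_ge0.
have [m Em] : exists m : R, `|c| ^+ 2 = m%:C.
  by exists (complex.Re c ^+ 2 + complex.Im c ^+ 2); rewrite -add_Re2_Im2 rmorphD !rmorphXn.
have m0 : 0 < m by rewrite -ltcR -Em exprn_gt0 ?normr_gt0.
have := sip_Re_cauchy_schwarz x (c *: y).
have -> : sq (c *: y) = m * sq y.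
  by apply: complexI; rewrite sqnormZ Em rmorphM.
have -> : q x (c *: y) = m%:C by rewrite sipZr mulrC -normCK.
rewrite expr2 Em lecR /=.
by rewrite [X in _ <= X]mulrCA ler_pM2l.
Qed.

(* [m] is the limit of a sequence minimising [sq v - 2 Re (l v)] over [M]. *)
Lemma riesz_on (M : set H) (l : H -> R[i]) (k : R) :
  M 0 -> (forall u v, M u -> M v -> M (u + v)) -> (forall a u, M u -> M (a *: u)) ->
  (forall u v, l (u + v) = l u + l v) -> (forall a u, l (a *: u) = a^* * l u) ->
  (forall v, M v -> 2 * complex.Re (l v) <= sq v + k) ->
  complete_for q M ->
  exists2 m, M m & forall v, M v -> q m v = l v.
Proof.
move=> M0 MD MZ lD lZ lk cpl.
pose phi v := sq v - 2 * complex.Re (l v).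
have lZr (s : R) v : complex.Re (l (s%:C *: v)) = s * complex.Re (l v).
  by rewrite lZ; case: (l v) => a b; rewrite /Num.conj /=; ring.
have lDr u v : complex.Re (l (u + v)) = complex.Re (l u) + complex.Re (l v).
  by rewrite lD raddfD.
pose S : set R := [set phi v | v in M].
have Slb : lbound S (- k).
  by move=> _ [v Mv <-]; have := lk _ Mv; rewrite /phi; lra.
have Si : has_inf S by split; [exists (phi 0), 0 | exists (- k)].
pose d := inf S.
have dle v : M v -> d <= phi v.
  by move=> Mv; apply: ge_inf; [case: Si | exists v].
have /choice [u Hu] : forall n : nat, exists v, M v /\ phi v < d + n.+1%:R^-1.
  move=> n; have [|_ [v Mv <-] vd] := @inf_adherent _ S n.+1%:R^-1 _ Si.
    by rewrite invr_gt0 ltr0Sn.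
  by exists v.
have small (e : R) : 0 < e -> exists n0, forall n, (n0 <= n)%N -> phi (u n) < d + e.
  move=> e0; exists (Num.truncn e^-1) => n hn; apply: lt_le_trans (proj2 (Hu n)) _.
  rewrite lerD2l -[leRHS]invrK lef_pV2 ?posrE ?invr_gt0 ?ltr0Sn //.
  apply: ltW; apply: lt_le_trans (truncnS_gt _) _; by rewrite ler_nat.
have [||m Mm mlim] := cpl u; first by move=> n; case: (Hu n).
  (* Parallelogram law: [sq (u n - u p)] equals [2 phi (u n) + 2 phi (u p)] minus four times [phi]
     at the midpoint, and the last value is at least [d]. *)
  move=> e e0; have [n0 hn0] := small (e / 4) ltac:(by lra).
  exists n0 => n p hn hp; have := hn0 _ hn; have := hn0 _ hp.
  have := dle (2^-1%:C *: u n + 2^-1%:C *: u p)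
    ltac:(by apply: MD; apply: MZ; [case: (Hu n)|case: (Hu p)]).
  rewrite /phi sqnorm_lincomb lDr !lZr sqnormB.
  lra.
have Re_eq v : M v -> complex.Re (q m v) = complex.Re (l v).
  move=> Mv; apply/eqP; rewrite -subr_eq0 -sqrf_eq0.
  have P0 := sqnorm_ge0 v; set P := sq v in P0.
  rewrite eq_le sqr_ge0 andbT; apply/ler_addgt0Pr => e e0; rewrite add0r.
  (* Below, [a ^+ 2 <= (P + 1) e'] and [b ^+ 2 <= P e'], hence
     [(a - b) ^+ 2 <= 2 a ^+ 2 + 2 b ^+ 2 <= e]. *)
  pose e' := e / (4 * (P + 1)).
  have e'0 : 0 < e' by rewrite divr_gt0 // mulr_gt0; lra.
  have eE : e = e' * (4 * (P + 1)) by rewrite /e' divfK //; lra.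
  have [n0 hn0] := small e' e'0; have [n1 hn1] := mlim _ e'0.
  have {hn0} := hn0 (maxn n0 n1) (leq_maxl _ _).
  have {hn1} := hn1 (maxn n0 n1) (leq_maxr _ _).
  set w := u _ => wm phiw.
  have Mw : M w by case: (Hu (maxn n0 n1)).
  set a := complex.Re (q w v) - complex.Re (l v).
  have ha : a ^+ 2 <= (P + 1) * e'.
    (* Nearly the minimiser of [phi] on the line through [w] in direction [v]; [P + 1] in place of
       [P] keeps the denominator positive. *)
    pose t := - a / (P + 1).
    have := dle (w + t%:C *: v) ltac:(by apply: MD => //; apply: MZ).
    rewrite /phi sqnormD lDr lZr -/P.
    move: phiw; rewrite /phi.
    move=> h1 h2.
    have tE : a = - t * (P + 1) by rewrite /t; field; lra.
    have h3 : - 2 * t * a - t ^+ 2 * P < e' by rewrite /a; lra.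
    have : t ^+ 2 * (P + 1) <= e' by move: h3; rewrite tE; nra.
    rewrite tE; nra.
  have hb : complex.Re (q m v) - complex.Re (q w v) = - complex.Re (q (w - m) v).
    by rewrite (sipDl qP) sipNl raddfD raddfN /=; ring.
  have := sip_Re_cauchy_schwarz (w - m) v; rewrite -/P.
  set b := complex.Re (q (w - m) v) in hb * => hb2.
  have -> : complex.Re (q m v) - complex.Re (l v) = a - b by rewrite /a; lra.
  have : b ^+ 2 <= e' * P by apply: le_trans hb2 _; rewrite ler_wpM2r.
  have : 0 <= (a + b) ^+ 2 by rewrite sqr_ge0.
  nra.
(* The real parts at [v] and at ['i *: v] determine the complex value. *)
exists m => // v Mv.
have := Re_eq _ (MZ 'i v Mv); have := Re_eq _ Mv.
rewrite sipZr lZ.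
case: (q m v) (l v) => [a b] [c e]; rewrite /Num.conj /= => -> h.
by congr (_ +i* _); move: h; lra.
Qed.

End SemiInnerProduct.

(** * Limits of complex-valued functions along filters *)

Section ComplexLimits.
Context (R : realType).

Definition tends (I : Type) (F : set_system I) (f : I -> R[i]) (l : R[i]) : Prop :=
  (f : I -> R[i]^o) @ F --> (l : R[i]^o).

Lemma tendsP (I : Type) (F : set_system I) (FF : Filter F) (f : I -> R[i]) l :
  tends F f l <-> (forall e : R, 0 < e -> \forall x \near F, `|f x - l| < e%:C).
Proof.
split=> [fl e e0|h].
  have e0' : 0 < e%:C by rewrite ltcR.
  apply: filterS (@cvgr_dist_lt _ R[i]^o _ _ _ _ _ fl _ e0') => x /=.
  by rewrite distrC.
apply/(@cvgrPdist_lt _ R[i]^o) => e e0.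
have eE : e = (complex.Re e)%:C by rewrite -[LHS]RRe_real // gtr0_real.
have := h (complex.Re e); rewrite -ltcR -eE => /(_ e0).
by apply: filterS => x /=; rewrite distrC.
Qed.

Lemma tends_cst (I : Type) (F : set_system I) (FF : Filter F) l : tends F (fun=> l) l.
Proof. exact: cvg_cst. Qed.

Lemma tendsD (I : Type) (F : set_system I) (FF : Filter F) (f g : I -> R[i]) a b :
  tends F f a -> tends F g b -> tends F (fun x => f x + g x) (a + b).
Proof. by move=> fa gb; apply: (cvgD fa gb). Qed.

Lemma tendsN (I : Type) (F : set_system I) (FF : Filter F) (f : I -> R[i]) a :
  tends F f a -> tends F (fun x => - f x) (- a).
Proof. by move=> fa; apply: (cvgN fa). Qed.

Lemma tendsB (I : Type) (F : set_system I) (FF : Filter F) (f g : I -> R[i]) a b :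
  tends F f a -> tends F g b -> tends F (fun x => f x - g x) (a - b).
Proof. by move=> fa gb; apply: (cvgB fa gb). Qed.

Lemma tendsM (I : Type) (F : set_system I) (FF : Filter F) (f g : I -> R[i]) a b :
  tends F f a -> tends F g b -> tends F (fun x => f x * g x) (a * b).
Proof. by move=> fa gb; apply: (cvgM fa gb). Qed.

Lemma tends_sum0 (I J : Type) (F : set_system I) (FF : Filter F) (r : seq J) (f : J -> I -> R[i]) :
  (forall j, tends F (f j) 0) -> tends F (fun x => \sum_(j <- r) f j x) 0.
Proof.
move=> h; elim: r => [|j r IH].
  by under eq_fun do rewrite big_nil; exact: tends_cst.
have -> : (fun x => \sum_(i <- j :: r) f i x) = (fun x => f j x + \sum_(i <- r) f i x).
  by apply/funext => x; rewrite big_cons.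
by have := tendsD FF (h j) IH; rewrite addr0.
Qed.

Lemma tends_conj (I : Type) (F : set_system I) (FF : Filter F) (f : I -> R[i]) a :
  tends F f a -> tends F (fun x => (f x)^*) a^*.
Proof.
move=> /(tendsP FF) fa; apply/(tendsP FF) => e /fa.
by apply: filterS => x /=; rewrite -rmorphB norm_conjC.
Qed.

Lemma tends_unique (I : Type) (F : set_system I) (FF : ProperFilter F) (f : I -> R[i]) a b :
  tends F f a -> tends F f b -> a = b.
Proof. by move=> fa fb; apply: (@cvg_unique R[i]^o _ _ _ _ _ fa fb). Qed.

Lemma tends_squeeze (I : Type) (F : set_system I) (FF : Filter F) (f g : I -> R[i]) :
  (forall x, `|f x| <= `|g x|) -> tends F g 0 -> tends F f 0.
Proof.
move=> fg /(tendsP FF) g0; apply/(tendsP FF) => e /g0.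
by apply: filterS => x /=; rewrite !subr0; apply: le_lt_trans.
Qed.

Lemma Re_dist_le (a b : R[i]) (e : R) :
  `|a - b| < e%:C -> `|complex.Re a - complex.Re b| < e /\ `|complex.Im a - complex.Im b| < e.
Proof.
have hN (z : R[i]) : `|complex.Re z|%:C <= `|z| /\ `|complex.Im z|%:C <= `|z|.
  case: z => x y; rewrite normc_def !lecR /= -!sqrtr_sqr.
  by rewrite !ler_wsqrtr // ?lerDl ?lerDr sqr_ge0.
move=> h; have [h1 h2] := hN (a - b).
have := le_lt_trans h1 h; have := le_lt_trans h2 h.
by rewrite !ltcR !raddfB.
Qed.

Lemma add_conjC (z : R[i]) : z + z^* = (2 * complex.Re z)%:C.
Proof. by case: z => x y; rewrite /Num.conj /= /GRing.add /=; congr (_ +i* _); ring. Qed.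

Lemma norm_le_ReIm (z : R[i]) : `|z| <= (`|complex.Re z| + `|complex.Im z|)%:C.
Proof.
case: z => x y; rewrite normc_def lecR /=.
rewrite -(ger0_norm (addr_ge0 (normr_ge0 x) (normr_ge0 y))) -sqrtr_sqr.
rewrite ler_wsqrtr // sqrrD !real_normK ?num_real // -addrA [_ *+ 2 + _]addrC addrA.
by rewrite lerDl mulrn_wge0 // mulr_ge0.
Qed.

Lemma tends_ReIm (I : Type) (F : set_system I) (FF : Filter F) (f : I -> R[i]) (a b : R) :
  complex.Re (f x) @[x --> F] --> a -> complex.Im (f x) @[x --> F] --> b ->
  tends F f (a +i* b).
Proof.
move=> fa fb; apply/(tendsP FF) => e e0.
have e20 : 0 < e / 2 by rewrite divr_gt0.
have hb : F [set x | `|b - complex.Im (f x)| < e / 2] := @cvgr_dist_lt _ _ _ F FF _ _ fb _ e20.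
have ha : F [set x | `|a - complex.Re (f x)| < e / 2] := @cvgr_dist_lt _ _ _ F FF _ _ fa _ e20.
apply: (@filterS _ F FF _ _ _ (@filterI _ F FF _ _ ha hb)) => x /= [h1 h2].
apply: le_lt_trans (norm_le_ReIm _) _.
rewrite ltcR [e]splitr; move: h1 h2.
rewrite ![`|_ - complex.Re _|]distrC ![`|_ - complex.Im _|]distrC.
case: (f x) => u v /= h1 h2; exact: ltrD.
Qed.

(** Compactness of the segment gives a cluster point [l]. For a neighbourhood [V] of [l], either its
    preimage or the complement of that preimage lies in [U], and clustering excludes the latter. *)
Lemma ultra_bounded_cvg (I : Type) (U : set_system I) (UU : UltraFilter U) (f : I -> R) (k : R) :
  (\forall x \near U, `|f x| <= k) -> exists l : R, f x @[x --> U] --> l.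
Proof.
move=> fk; have [|l [_ fl]] := @segment_compact R (- k) k (f @ U) _.
  by apply: filterS fk => x; rewrite /= in_itv /= ler_norml.
exists l => V Vl; have [//|UV] := in_ultra_setVsetC (f @^-1` V) UU.
by have [y [/= nVy Vy]] := fl (~` V) V UV Vl.
Qed.

Lemma ultra_bounded_tends (I : Type) (U : set_system I) (UU : UltraFilter U)
    (f : I -> R[i]) (k : R) :
  (\forall x \near U, `|f x| <= k%:C) -> exists l, tends U f l.
Proof.
move=> fk.
have fk' : \forall x \near U, `|complex.Re (f x)| <= k + 1 /\ `|complex.Im (f x)| <= k + 1.
  apply: filterS fk => x fx.
  have [] := @Re_dist_le (f x) 0 (k + 1).
    by rewrite subr0; apply: le_lt_trans fx _; rewrite ltcR ltrDl.
  by rewrite /= !subr0 => /ltW-> /ltW->.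
have [|a fa] := @ultra_bounded_cvg _ U UU (fun x => complex.Re (f x)) (k + 1).
  by apply: filterS fk' => x [].
have [|b fb] := @ultra_bounded_cvg _ U UU (fun x => complex.Im (f x)) (k + 1).
  by apply: filterS fk' => x [].
by exists (a +i* b); apply: tends_ReIm.
Qed.

Lemma tends_le (I : Type) (F : set_system I) (FF : ProperFilter F) (f : I -> R[i]) l (a : R) :
  (\forall x \near F, complex.Re (f x) <= a) -> tends F f l -> complex.Re l <= a.
Proof.
move=> fa /(tendsP _) fl; apply/ler_addgt0Pr => e /fl fe.
have [x [h1 /Re_dist_le [h2 _]]] := filter_ex (filterI fa fe).
by move: h2; rewrite ltr_norml => /andP[]; lra.
Qed.

Lemma tends_fmap (I J : Type) (F : set_system I) (h : I -> J) (f : J -> R[i]) l :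
  tends F (fun x => f (h x)) l -> tends (h @ F) f l.
Proof. by []. Qed.

End ComplexLimits.
Arguments tends_cst {R I F} FF l.

(** * Convexity of the numerical range of a semi-norm bounded operator *)

Section NumericalRange.
Context (R : realType) (H : lmodType R[i]).
Context (q : H -> H -> R[i]) (qP : semi_inner_product q).
Local Notation sq := (sqnorm q).

Definition num_range (B : H -> H) : set R[i] :=
  [set q (B x) x | x in [set x | sq x = 1]].

(** Cauchy-Schwarz makes null vectors invisible to the form; this stands in for definiteness. *)
Lemma sqnorm_eq0 w v : sq w = 0 -> q w v = 0 /\ q v w = 0.
Proof.
move=> w0; have := sip_cauchy_schwarz qP w v.
rewrite w0 mul0r rmorph0 => h.
have : `|q w v| ^+ 2 = 0 by apply: le_anti; rewrite h exprn_ge0.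
move=> /eqP; rewrite expf_eq0 normr_eq0 /= => /eqP wv; split; first exact: wv.
by rewrite (sipC qP) wv rmorph0.
Qed.

Context (B : {linear H -> H}) (c : R).
Context (Bc : forall x, sq (B x) <= c * sq x).

Lemma num_range_ray w (z : R[i]) :
  sq w != 0 -> q (B w) w = z * (sq w)%:C -> num_range B z.
Proof.
move=> w0 wz; have w_gt0 : 0 < sq w by rewrite lt0r w0 sqnorm_ge0.
exists ((Num.sqrt (sq w))^-1%:C *: w) => /=.
  by rewrite (sqnormZr qP) exprVn sqr_sqrtr ?mulVf // ltW.
rewrite linearZ (sipZl qP) (sipZr qP) wz.
have -> : ((Num.sqrt (sq w))^-1%:C)^* = (Num.sqrt (sq w))^-1%:C.
  by apply: conj_Creal; rewrite complex_real.
rewrite mulrA mulrCA mulrA -[LHS]mulrA -rmorphM -[X in _ * X]rmorphM.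
rewrite -expr2 exprVn sqr_sqrtr ?mulVf ?mulr1 // ltW //.
Qed.

(* For unit [x], [y] with values [a], [b], the value of the intermediate point [k] is
   reached at a vector [x + s lam y]: for a suitable phase [lam] the condition on
   the real number [s] is a real quadratic equation whose extreme coefficients
   [1 - t] and [- |lam|^2 t] have opposite signs. *)
Lemma num_range_convex a b (t : R) : 0 <= t <= 1 ->
  num_range B a -> num_range B b -> num_range B (t%:C * a + (1 - t)%:C * b).
Proof.
move=> /andP[t0 t1] Wa Wb.
have [->|t0'] := eqVneq t 0; first by rewrite subr0 mul0r mul1r add0r.
have [->|t1'] := eqVneq t 1; first by rewrite subrr mul0r mul1r addr0.
have [->|ab] := eqVneq a b.
  by rewrite -mulrDl -rmorphD addrC subrK rmorph1 mul1r.
have {}t0 : 0 < t by rewrite lt0r t0'.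
have {}t1 : t < 1 by rewrite lt_neqAle t1'.
case: Wa Wb => x /= x1 xa [y /= y1 yb].
set k := _ + _.
have d0 : a - b != 0 by rewrite subr_eq0.
(* The form of [B - k], normalised to take the real values [1 - t] at [x] and [- t] at [y]. A
   non-null vector on which it vanishes has value [k]. *)
pose g u v := (q (B u) v - k * q u v) / (a - b).
pose p := g x y; pose r := g y x.
have [lam [L [beta [L0 LE lamE]]]] : exists lam, exists L beta : R,
    [/\ 0 < L, lam * lam^* = L%:C & lam^* * p + lam * r = beta%:C].
  have [pr|pr] := eqVneq p r^*.
    exists 1, 1, (2 * complex.Re p); split=> //; first by rewrite rmorph1 mulr1.
    have -> : r = p^* by rewrite pr conjCK.
    by rewrite rmorph1 !mul1r add_conjC.
  have sqE z : exists2 L : R, 0 <= L & z * z^* = L%:C.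
    exists (complex.Re z ^+ 2 + complex.Im z ^+ 2); first by rewrite addr_ge0 ?sqr_ge0.
    by rewrite -normCK -add_Re2_Im2 rmorphD !rmorphXn.
  (* For [lam = p - r^*] the mixed terms [p * r] cancel, leaving the real number [|p|^2 - |r|^2]. *)
  have [P _ PE] := sqE p; have [Q _ QE] := sqE r; have [L L0 LE] := sqE (p - r^*).
  exists (p - r^*), L, (P - Q); split=> //.
    rewrite lt0r L0 andbT; apply: contraNneq pr => L00; move: LE; rewrite L00 => /eqP.
    by rewrite mulf_eq0 conjC_eq0 orbb subr_eq0 => /eqP ->.
  by rewrite rmorphB /= conjCK rmorphB /= -PE -QE; ring.
pose K := L * t; have K0 : 0 < K by rewrite mulr_gt0.
pose Delta := beta ^+ 2 + 4 * K * (1 - t).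
have D0 : 0 <= Delta by rewrite addr_ge0 ?sqr_ge0 // mulr_ge0 ?mulr_ge0 ?subr_ge0 // ltW.
pose s := (beta + Num.sqrt Delta) / (2 * K).
have sE : (1 - t) + s * beta - s ^+ 2 * K = 0.
  have : Num.sqrt Delta ^+ 2 = Delta by rewrite sqr_sqrtr.
  have K2 : 2 * K != 0 by rewrite mulf_neq0 ?pnatr_eq0 // gt_eqF.
  have -> : Num.sqrt Delta = s * (2 * K) - beta by rewrite /s divfK //; ring.
  rewrite /Delta => h.
  have {h} : 4 * K * ((1 - t) + s * beta - s ^+ 2 * K) = 0 by lra.
  have K4 : 4 * K != 0 by rewrite mulf_neq0 ?pnatr_eq0 // gt_eqF.
  by move/eqP; rewrite mulf_eq0 (negPf K4) => /eqP.
clearbody s.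
pose w := x + (s%:C * lam) *: y.
have sC : (s%:C)^* = s%:C by apply: conj_Creal; rewrite complex_real.
have qx : q x x = 1 by rewrite (sip_sqnorm qP) x1.
have qy : q y y = 1 by rewrite (sip_sqnorm qP) y1.
have wE : q (B w) w - k * q w w = 0.
  have gxx : q (B x) x - k * q x x = (a - b) * (1 - t)%:C.
    by rewrite xa qx /k; rewrite rmorphB rmorph1; ring.
  have gyy : q (B y) y - k * q y y = - (a - b) * t%:C.
    by rewrite yb qy /k; rewrite rmorphB rmorph1; ring.
  have gxy : q (B x) y - k * q x y = (a - b) * p by rewrite /p /g [RHS]mulrC divfK.
  have gyx : q (B y) x - k * q y x = (a - b) * r by rewrite /r /g [RHS]mulrC divfK.
  have -> : q (B w) w - k * q w w = (q (B x) x - k * q x x)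
      + s%:C * (lam^* * (q (B x) y - k * q x y) + lam * (q (B y) x - k * q y x))
      + s%:C ^+ 2 * (lam * lam^*) * (q (B y) y - k * q y y).
    rewrite /w linearD linearZ /= !(sipDl qP) !(sipDr qP) !(sipZl qP) !(sipZr qP).
    by rewrite !rmorphM /= sC; ring.
  rewrite gxx gyy gxy gyx LE.
  have -> : lam^* * ((a - b) * p) + lam * ((a - b) * r) = (a - b) * beta%:C.
    by rewrite -lamE; ring.
  have -> : (a - b) * (1 - t)%:C + s%:C * ((a - b) * beta%:C) +
    s%:C ^+ 2 * L%:C * (- (a - b) * t%:C) = (a - b) * ((1 - t) + s * beta - s ^+ 2 * K)%:C.
    by rewrite /K !(rmorphD, rmorphB, rmorphM, rmorphXn) /=; ring.
  by rewrite sE rmorph0 mulr0.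
apply: (@num_range_ray w); last first.
  by apply/eqP; rewrite -(sip_sqnorm qP) -subr_eq0 wE.
(* If [w] were null, [x] and [- sg *: y] would differ by a null vector, forcing [|sg| = 1] and
   [a = b]. *)
apply/eqP => w0.
have Bw0 : sq (B w) = 0.
  by apply/eqP; rewrite eq_le sqnorm_ge0 // andbT (le_trans (Bc w)) // w0 mulr0.
pose sg := s%:C * lam.
have xE : x = w - sg *: y by rewrite /w addrK.
clearbody w sg.
have w0' v := sqnorm_eq0 v w0; have Bw0' v := sqnorm_eq0 v Bw0.
have aE : a = sg * sg^* * b.
  rewrite -xa -yb {1 2}xE linearB linearZ /= !(sipDl qP) !(sipDr qP) !(sipNl qP) !(sipNr qP).
  rewrite (sipZl qP) !(sipZr qP) (sipZl qP).
  by rewrite !(proj1 (Bw0' _)) !(proj2 (w0' _)); ring.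
have oneE : sg * sg^* = 1.
  rewrite -qx xE !(sipDl qP) !(sipDr qP) !(sipNl qP) !(sipNr qP).
  rewrite (sipZl qP) !(sipZr qP) (sipZl qP) qy.
  by rewrite !(proj1 (w0' _)) !(proj2 (w0' _)); ring.
by move: ab; rewrite aE oneE mul1r eqxx.
Qed.

Lemma num_range_square (x y h : R) (mu : R[i]) :
  num_range B (x +i* y) -> num_range B ((x + h) +i* y) ->
  num_range B (x +i* (y + h)) -> num_range B ((x + h) +i* (y + h)) ->
  x <= complex.Re mu <= x + h -> y <= complex.Im mu <= y + h ->
  num_range B mu.
Proof.
case: mu => u v /= W00 W10 W01 W11 /andP[u1 u2] /andP[v1 v2].
have [h0|h0] := eqVneq h 0.
  have -> : u = x by lra.
  by have -> : v = y by lra.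
have hp : 0 < h by rewrite lt0r h0; lra.
(* Weights of the left and of the lower side: interpolation along both horizontal edges, then
   vertically between the two results. *)
pose s := (x + h - u) / h; pose t := (y + h - v) / h.
have sb : 0 <= s <= 1.
  by rewrite divr_ge0 ?ler_pdivrMr //; lra.
have tb : 0 <= t <= 1.
  by rewrite divr_ge0 ?ler_pdivrMr //; lra.
have := num_range_convex tb (num_range_convex sb W00 W10) (num_range_convex sb W01 W11).
congr (num_range B); simpc; rewrite /s /t.
by congr (_ +i* _); field.
Qed.

End NumericalRange.

(** * Essential values and closedness of the numerical range *)

Section EssentialRange.
Context (R : realType) (H : lmodType R[i]).
Context (q : H -> H -> R[i]) (qP : semi_inner_product q).
Local Notation sq := (sqnorm q).

Lemma norm_realC (a : R) : `|a%:C| = `|a|%:C.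
Proof. by rewrite normc_def /= expr0n addr0 sqrtr_sqr. Qed.

(** The squared semi-norm is only required to tend to 1, so that subtracting projections stays
    within the notion; normalisation is postponed until a vector is picked. *)
Definition essential_net (B : H -> H) (mu : R[i]) (F : set_system H) : Prop :=
  [/\ forall f, tends F (fun x => q x f) 0, tends F (fun x => q x x) 1 &
      tends F (fun x => q (B x) x) mu].

Definition ess_num_range (B : H -> H) (mu : R[i]) : Prop :=
  exists2 F : set_system H, ProperFilter F & essential_net B mu F.

Lemma sip_norm_le x y (k : R) : sq x <= k * sq y -> `|q x y| <= ((`|k| + 1) * sq y)%:C.
Proof.
move=> xy; have y0 := sqnorm_ge0 qP y.
have k0 : 0 <= (`|k| + 1) * sq y by rewrite mulr_ge0 ?addr_ge0.
rewrite -(@ler_pXn2r _ 2) ?nnegrE ?normr_ge0 ?lecR //.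
apply: le_trans (sip_cauchy_schwarz qP x y) _.
rewrite -rmorphXn lecR exprMn expr2 [sq y ^+ 2]expr2 mulrA ler_wpM2r //.
apply: le_trans xy _; rewrite ler_wpM2r //.
have := ler_norm k; have : 0 <= `|k| by [].
by nra.
Qed.

Lemma sip_norm_le1 x f : sq x = 1 -> `|q x f| <= (sq f + 1)%:C.
Proof.
move=> x1; have f0 := sqnorm_ge0 qP f.
rewrite -(@ler_pXn2r _ 2) ?nnegrE ?normr_ge0 ?lecR ?addr_ge0 //.
apply: le_trans (sip_cauchy_schwarz qP x f) _.
by rewrite -rmorphXn lecR x1 mul1r; nra.
Qed.

Lemma sip_eq_of_null x y : sq (x - y) = 0 -> forall f, q x f = q y f.
Proof.
move=> xy f; have [+ _] := sqnorm_eq0 qP f xy.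
by rewrite (sipDl qP) (sipNl qP) => /eqP; rewrite subr_eq0 => /eqP.
Qed.

Section BoundedOperator.
Context (B : {linear H -> H}) (c : R).
Context (Bc : forall x, sq (B x) <= c * sq x).

(** A semi-norm bounded [B] preserves null vectors, so its quadratic form descends to classes modulo
    them. *)
Lemma quad_eq_of_null x y : sq (x - y) = 0 -> q (B x) x = q (B y) y.
Proof.
move=> xy.
have -> : q (B x) x = q (B y) x.
  apply: sip_eq_of_null; rewrite -linearB; apply: le_anti.
  by rewrite sqnorm_ge0 // andbT (le_trans (Bc _)) // xy mulr0.
by rewrite (sipC qP) (sip_eq_of_null xy) -(sipC qP).
Qed.

Context (q_complete : complete_for q setT).

(** Riesz representation of the conjugate-linear functional sending [v] to [q f (B v)]. *)
Lemma adjoint_exists f : exists g, forall v, q (B v) f = q v g.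
Proof.
pose k := `|c| + 1; have k1 : 1 <= k by rewrite lerDr.
have Bk v : sq (B v) <= k * sq v.
  apply: le_trans (Bc v) _; rewrite ler_wpM2r ?sqnorm_ge0 //.
  by rewrite /k; have := ler_norm c; lra.
have [|||||||g _ gP] := @riesz_on _ _ _ qP setT (fun v => q f (B v)) (k ^+ 2 * sq f) => //.
- by move=> u v; rewrite linearD (sipDr qP).
- by move=> a u; rewrite linearZ (sipZr qP).
(* Weighted arithmetic-geometric inequality: the factor [k^-1] absorbs the bound of [B], since
   [k >= 1]. *)
- move=> v _; have := sqnorm_ge0 qP (k%:C *: f + (- k^-1)%:C *: B v).
  rewrite sqnorm_lincomb //.
  have -> : 2 * k * - k^-1 * complex.Re (q f (B v)) = - (2 * complex.Re (q f (B v))).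
    by field; lra.
  have : (- k^-1) ^+ 2 * sq (B v) <= sq v.
    rewrite sqrrN exprVn mulrC ler_pdivrMr ?exprn_gt0 //; last by lra.
    apply: le_trans (Bk v) _; rewrite mulrC ler_wpM2l ?sqnorm_ge0 //.
    by nra.
  by lra.
by exists g => v; rewrite [LHS](sipC qP) -gP // -(sipC qP).
Qed.

(* Along an ultrafilter the unit vectors [x n] converge weakly to some [x0]; with
   [t = sq x0], the limit [z] is [q (B x0) x0 + (1 - t) mu] for an essential value [mu]. *)
Lemma num_range_closed :
  (forall mu, ess_num_range B mu -> num_range q B mu) ->
  forall z, (forall e : R, 0 < e -> exists2 w, num_range q B w & `|w - z| < e%:C) ->
  num_range q B z.
Proof.
move=> EW z zP.
have /choice [x xP] : forall n : nat, exists x : H,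
    sq x = 1 /\ `|q (B x) x - z| < (n.+1%:R^-1)%:C.
  move=> n; have [|w [x x1 <-] xz] := zP n.+1%:R^-1; first by rewrite invr_gt0.
  by exists x.
(* Along one ultrafilter all the bounded sequences [q (x n) f] converge at once. *)
have [U [UU sU]] := @ultraFilterLemma nat \oo _.
have FU : Filter U by exact: filter_filter.
have xz : tends U (fun n => q (B (x n)) (x n)) z.
  apply/(tendsP FU) => e e0; apply: sU; near=> n.
  apply: lt_trans (proj2 (xP n)) _; rewrite ltcR.
  rewrite -[X in _ < X]invrK ltf_pV2 ?posrE ?invr_gt0 //.
  rewrite -natr1 ltr_wpDr //; near: n; exact: nbhs_infty_gtr.
have /choice [l lP] : forall f, exists l, tends U (fun n => q (x n) f) l.
  move=> f; apply: (ultra_bounded_tends UU (k := sq f + 1)).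
  by apply: nearW => n; apply: sip_norm_le1; case: (xP n).
have [|||||||x0 _ x0P] := @riesz_on _ _ _ qP setT l 1 => //.
- move=> u v; apply: (tends_unique _ (lP (u + v))).
  by have := tendsD FU (lP u) (lP v); under eq_fun do rewrite -(sipDr qP).
- move=> a u; apply: (tends_unique _ (lP (a *: u))).
  by have := tendsM FU (tends_cst FU a^*) (lP u); under eq_fun do rewrite -(sipZr qP).
- move=> v _; suff : complex.Re (l v) <= (sq v + 1) / 2 by lra.
  apply: (tends_le _ _ (lP v)); apply: nearW => n.
  have := sqnorm_ge0 qP (x n - v); rewrite (sqnormB qP) (proj1 (xP n)).
  by lra.
have xw f : tends U (fun n => q (x n) f) (q x0 f).
  rewrite x0P; [exact: lP | by []].
have xw' f : tends U (fun n => q f (x n)) (q f x0).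
  by have := tends_conj FU (xw f); under eq_fun do rewrite -(sipC qP); rewrite -(sipC qP).
pose t := sq x0; pose y n := x n - x0.
have t0 : 0 <= t by exact: sqnorm_ge0.
have yf f : tends U (fun n => q (y n) f) 0.
  have -> : (fun n => q (y n) f) = (fun n => q (x n) f - q x0 f).
    by apply/funext => n; rewrite (sipDl qP) (sipNl qP).
  rewrite -(subrr (q x0 f)); apply: (tendsB FU); [exact: xw | exact: tends_cst].
have yy : tends U (fun n => q (y n) (y n)) (1 - t)%:C.
  have -> : (fun n => q (y n) (y n)) = (fun n => 1 - q (x n) x0 - (q x0 (x n) - q x0 x0)).
    apply/funext => n; rewrite !(sipDl qP, sipDr qP, sipNl qP, sipNr qP).
    by rewrite (sip_sqnorm qP (x n)) (proj1 (xP n)); ring.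
  have -> : (1 - t)%:C = 1 - q x0 x0 - (q x0 x0 - q x0 x0).
    by rewrite subrr subr0 rmorphB rmorph1 (sip_sqnorm qP x0).
  apply: (tendsB FU); apply: (tendsB FU);
    [exact: tends_cst|exact: xw|exact: xw'|exact: tends_cst].
(* The cross term [q (B (x n)) x0] becomes [q (x n) g], to which weak convergence applies. *)
have By : tends U (fun n => q (B (y n)) (y n)) (z - q (B x0) x0).
  have [g gP] := adjoint_exists x0.
  have -> : (fun n => q (B (y n)) (y n)) =
      (fun n => q (B (x n)) (x n) - q (x n) g - (q (B x0) (x n) - q (B x0) x0)).
    apply/funext => n; rewrite /y linearB.
    by rewrite !(sipDl qP, sipDr qP, sipNl qP, sipNr qP) (gP (x n)); ring.
  have -> : z - q (B x0) x0 = z - q x0 g - (q (B x0) x0 - q (B x0) x0).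
    by rewrite gP; ring.
  apply: (tendsB FU); apply: (tendsB FU);
    [exact: xz|exact: xw|exact: xw'|exact: tends_cst].
have t1 : 0 <= 1 - t.
  rewrite -oppr_le0; apply: (tends_le _ _ (tendsN FU yy)); apply: nearW => n.
  by rewrite raddfN oppr_le0; exact: sqnorm_ge0.
(* No mass escapes when [t = 1]: the [y n] vanish in semi-norm and [x0] itself attains [z]. *)
have [t1'|t1'] := eqVneq (1 - t) 0.
  have By0 : tends U (fun n => q (B (y n)) (y n)) 0.
    apply: (tends_squeeze FU (g := fun n => (`|c| + 1)%:C * q (y n) (y n))).
      move=> n; apply: le_trans (sip_norm_le (Bc (y n))) _.
      have : 0 <= (`|c| + 1) * sq (y n) by rewrite mulr_ge0 ?addr_ge0 ?sqnorm_ge0.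
      by rewrite (sip_sqnorm qP) -rmorphM norm_realC => /ger0_norm ->.
    by have := tendsM FU (tends_cst FU (`|c| + 1)%:C) yy; rewrite t1' rmorph0 mulr0.
  exists x0; first by rewrite /= -/t; lra.
  by apply/eqP; rewrite eq_sym -subr_eq0; apply/eqP; apply: (tends_unique _ By).
have r0 : 0 < 1 - t by rewrite lt0r t1'.
set r := 1 - t in r0 t1' *.
have rC : r%:C != 0 by rewrite fmorph_eq0.
pose mu := (z - q (B x0) x0) / r%:C.
have Wmu : num_range q B mu.
  apply: EW; pose s := (Num.sqrt r)^-1%:C.
  have sC : s^* = s by apply: conj_Creal; rewrite complex_real.
  have ss : s * s = r%:C^-1.
    by rewrite -rmorphM -expr2 exprVn sqr_sqrtr ?(ltW r0) // fmorphV.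
  exists ((fun n => s *: y n) @ U); first exact: fmap_proper_filter.
  split=> [f||].
  - apply: tends_fmap; have := tendsM FU (tends_cst FU s) (yf f); rewrite mulr0.
    by under eq_fun do rewrite -(sipZl qP).
  - apply: tends_fmap; have := tendsM FU (tends_cst FU r%:C^-1) yy; rewrite (mulVf rC).
    have -> : (fun n => r%:C^-1 * q (y n) (y n)) = (fun n => q (s *: y n) (s *: y n)).
      by apply/funext => n; rewrite (sipZl qP) (sipZr qP) sC mulrA ss.
    exact.
  - apply: tends_fmap; have := tendsM FU (tends_cst FU r%:C^-1) By; rewrite mulrC.
    have -> : (fun n => r%:C^-1 * q (B (y n)) (y n)) = (fun n => q (B (s *: y n)) (s *: y n)).
      by apply/funext => n; rewrite linearZ (sipZl qP) (sipZr qP) sC mulrA ss.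
    exact.
have zE : z = r%:C * mu + q (B x0) x0 by rewrite /mu mulrC divfK // subrK.
(* For [t = 0] the vector [x0] is null and cannot be normalised, but then [z = mu]. *)
have [t00|t00] := eqVneq t 0.
  have -> : z = mu.
    rewrite zE /r t00 subr0 mul1r; have [_ ->] := sqnorm_eq0 qP (B x0) t00.
    by rewrite addr0.
  by [].
have tC : t%:C != 0 by rewrite fmorph_eq0.
have -> : z = t%:C * (q (B x0) x0 / t%:C) + (1 - t)%:C * mu.
  by rewrite [t%:C * _]mulrC divfK // addrC.
apply: (num_range_convex qP Bc) => //; first by rewrite t0; lra.
by apply: (num_range_ray qP (w := x0)); rewrite ?divfK.
Unshelve. all: by end_near.
Qed.

(** The coefficient [q x e] tends to 0, so every correction term tends to 0; the adjoint handles
    [q (B x) e]. *)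
Lemma essential_net_project mu F (e : H) : ProperFilter F -> essential_net B mu F ->
  essential_net B mu ((fun x => x - q x e *: e) @ F).
Proof.
move=> PF [Ff F1 FB].
have FF : Filter F by exact: filter_filter.
have Fr f : tends F (fun x => q f x) 0.
  have := tends_conj FF (Ff f); rewrite rmorph0.
  by under eq_fun do rewrite -(sipC qP).
have Fe : tends F (fun x => q x e * q e x) 0.
  by have := tendsM FF (Ff e) (Fr e); rewrite mulr0.
split=> [f||].
- apply: tends_fmap.
  have -> : (fun x => q (x - q x e *: e) f) = (fun x => q x f - q x e * q e f).
    by apply/funext => x /=; rewrite (sipDl qP) (sipNl qP) (sipZl qP).
  have := tendsB FF (Ff f) (tendsM FF (Ff e) (tends_cst FF (q e f))).
  by rewrite mul0r subr0.
- apply: tends_fmap.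
  have -> : (fun x => q (x - q x e *: e) (x - q x e *: e)) =
      (fun x => q x x - q x e * q e x * (2 - q e e)).
    apply/funext => x /=.
    rewrite !(sipDl qP, sipDr qP, sipNl qP, sipNr qP, sipZl qP, sipZr qP).
    by rewrite -!(sipC qP); ring.
  have := tendsB FF F1 (tendsM FF Fe (tends_cst FF (2 - q e e))).
  by rewrite mul0r subr0.
- have [g gP] := adjoint_exists e.
  apply: tends_fmap.
  have -> : (fun x => q (B (x - q x e *: e)) (x - q x e *: e)) =
      (fun x => q (B x) x - q e x * q x g - q x e * q (B e) x + q x e * q e x * q (B e) e).
    apply/funext => x /=.
    rewrite linearB linearZ /=.
    rewrite !(sipDl qP, sipDr qP, sipNl qP, sipNr qP, sipZl qP, sipZr qP).
    by rewrite -!(sipC qP) (gP x); ring.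
  have := tendsD FF (tendsB FF (tendsB FF FB (tendsM FF (Fr e) (Ff g)))
    (tendsM FF (Ff e) (Fr (B e)))) (tendsM FF Fe (tends_cst FF (q (B e) e))).
  by rewrite !mul0r !subr0 addr0.
Qed.

Definition orthonormal_upto (n : nat) (e : nat -> H) : Prop :=
  forall i j, (i < n)%N -> (j < n)%N -> q (e i) (e j) = (i == j)%:R.

(** The vectors [e i] are projected off one at a time; orthonormality keeps the orthogonality
    already obtained. *)
Lemma ess_num_range_orthogonal mu n (e : nat -> H) :
  ess_num_range B mu -> orthonormal_upto n e ->
  exists2 F : set_system H, ProperFilter F &
    essential_net B mu F /\ \forall x \near F, forall i, (i < n)%N -> q x (e i) = 0.
Proof.
move=> [F PF FP]; elim: n => [|n IH] en.
  by exists F => //; split=> //; apply: nearW.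
have [|G PG [GP G0]] := IH.
  by move=> i j im jm; apply: en; apply: ltnW.
exists ((fun x => x - q x (e n) *: e n) @ G); first exact: fmap_proper_filter.
split; first exact: essential_net_project.
apply: filterS G0 => x /= x0 i; rewrite ltnS leq_eqVlt.
rewrite (sipDl qP) (sipNl qP) (sipZl qP) => /orP[/eqP ->|im].
  by rewrite en // eqxx mulr1 subrr.
by rewrite x0 // en // ?ltnS ?(ltnW im) // gtn_eqF // mulr0 subrr.
Qed.

Lemma ess_num_range_unit mu n (e : nat -> H) (eta : R) : 0 < eta ->
  ess_num_range B mu -> orthonormal_upto n e ->
  exists x, [/\ q x x = 1, forall i, (i < n)%N -> q x (e i) = 0 &
    `|q (B x) x - mu| < eta%:C].
Proof.
move=> eta0 Emu en.
have [F PF [[_ F1 FB] F0]] := ess_num_range_orthogonal Emu en.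
have FF : Filter F by exact: filter_filter.
have e20 : 0 < eta / 2 by rewrite divr_gt0.
have h20 : 0 < 2^-1 :> R by rewrite invr_gt0.
(* Normalising [x] divides this difference by [sq x > 1/2], which at most doubles an error of
   [eta / 2]. *)
have FD : tends F (fun x => q (B x) x - mu * q x x) 0.
  have := tendsB FF FB (tendsM FF (tends_cst FF mu) F1).
  by rewrite mulr1 subrr.
have h1 := @filterI _ F FF _ _ F0 (proj1 (tendsP FF _ _) F1 _ h20).
have h2 := @filterI _ F FF _ _ h1 (proj1 (tendsP FF _ _) FD _ e20).
have [x [[x0 x1] xD]] := @filter_ex _ F PF _ h2.
have {}x1 : 2^-1 < sq x.
  by have [+ _] := Re_dist_le x1; rewrite ltr_norml /sqnorm /= => /andP[]; lra.
have sx0 : 0 < sq x by lra.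
have sxC : (sq x)%:C != 0 by rewrite fmorph_eq0 gt_eqF.
pose s := (Num.sqrt (sq x))^-1%:C.
have sC : s^* = s by apply: conj_Creal; rewrite complex_real.
have ss : s * s = (sq x)%:C^-1.
  by rewrite -rmorphM -expr2 exprVn sqr_sqrtr ?(ltW sx0) // fmorphV.
exists (s *: x); split.
- by rewrite (sipZl qP) (sipZr qP) sC mulrA ss (sip_sqnorm qP) mulVf.
- by move=> i im; rewrite (sipZl qP) x0 // mulr0.
rewrite linearZ (sipZl qP) (sipZr qP) sC mulrA ss.
have -> : (sq x)%:C^-1 * q (B x) x - mu = (sq x)%:C^-1 * (q (B x) x - mu * q x x).
  by rewrite (sip_sqnorm qP x); field.
rewrite normrM -fmorphV ger0_norm ?lecR ?invr_ge0 ?(ltW sx0) //.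
move: xD; rewrite subr0 => xD.
apply: lt_le_trans (_ : (sq x)^-1%:C * (eta / 2)%:C <= _).
  by rewrite ltr_pM2l // ltcR invr_gt0.
rewrite -rmorphM lecR mulrC ler_pdivrMr //.
by nra.
Qed.

(** Each new unit vector is taken orthogonal to the previous ones, then replaced by a representative
    in [M], which changes neither products nor values of [B]. Later [M] is the range of [A]. *)
Lemma ess_num_range_family (M : set H) n (mu : nat -> R[i]) (eta : R) :
  (forall x, exists2 r, M r & sq (x - r) = 0) -> 0 < eta ->
  (forall j, (j < n)%N -> ess_num_range B (mu j)) ->
  exists e : nat -> H, [/\ forall j, (j < n)%N -> M (e j), orthonormal_upto n e &
    forall j, (j < n)%N -> `|q (B (e j)) (e j) - mu j| < eta%:C].
Proof.
move=> MP eta0; elim: n => [|n IH] Emu.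
  by exists (fun=> 0); split.
have [|e [eM en emu]] := IH; first by move=> j jn; apply: Emu; apply: ltnW.
have [x [x1 x0 xmu]] := ess_num_range_unit eta0 (Emu n (ltnSn n)) en.
have [r rM xr] := MP x.
have xrE := sip_eq_of_null xr.
exists (fun j => if (j < n)%N then e j else r); split.
- by move=> j _; case: ifP => // /eM.
- move=> i j; rewrite !ltnS => im jm.
  case: ltnP => [im'|ni]; case: ltnP => [jm'|nj]; first exact: en.
  + by rewrite (sipC qP) -xrE x0 // rmorph0 ltn_eqF // (leq_trans im').
  + by rewrite -xrE x0 // gtn_eqF // (leq_trans jm').
  + have -> : i = n by apply/eqP; rewrite eqn_leq im.
    have -> : j = n by apply/eqP; rewrite eqn_leq jm.
    by rewrite -xrE (sipC qP) -xrE -(sipC qP) x1 eqxx.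
move=> j; rewrite ltnS leq_eqVlt => /orP[/eqP ->|jn]; last by rewrite jn; exact: emu.
by rewrite ltnn -(quad_eq_of_null xr).
Qed.

Lemma ess_num_range_bounded : exists k : R, forall mu, ess_num_range B mu ->
  `|complex.Re mu| <= k /\ `|complex.Im mu| <= k.
Proof.
exists (`|c| + 2) => mu Emu.
have [|x [x1 _ xmu]] := @ess_num_range_unit mu 0 (fun=> 0) 1 ltr01 Emu; first by [].
have sx : sq x = 1 by rewrite /sqnorm x1.
have : `|mu - 0| < (`|c| + 2)%:C.
  have -> : mu - 0 = q (B x) x - (q (B x) x - mu) by ring.
  apply: le_lt_trans (ler_normB _ _) _.
  have -> : (`|c| + 2)%:C = ((`|c| + 1) * sq x)%:C + 1%:C.
    by rewrite -rmorphD sx; congr (_%:C); ring.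
  exact: ler_ltD (sip_norm_le (Bc x)) xmu.
by move=> /Re_dist_le; rewrite /= !subr0 => -[/ltW -> /ltW ->].
Qed.

End BoundedOperator.
End EssentialRange.

(** * Covering a bounded planar set by grid cells *)

Section FiniteGrid.
Context (R : realType).

(* [x + i y] is the lower left corner of a grid cell of side [delta] containing [z];
   the [lam j] are the grid points close to [E]. *)
Lemma grid_cover (E : R[i] -> Prop) (k delta : R) : 0 < delta ->
  (forall z, E z -> `|complex.Re z| <= k /\ `|complex.Im z| <= k) ->
  exists (n : nat) (lam mu : nat -> R[i]),
    (forall j, (j < n)%N -> E (mu j) /\ `|lam j - mu j| <= (2 * delta)%:C) /\
    forall z, E z -> exists x y : R,
      [/\ x <= complex.Re z <= x + delta, y <= complex.Im z <= y + delta &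
        forall u v, u \in [:: x; x + delta] -> v \in [:: y; y + delta] ->
          exists2 j, (j < n)%N & lam j = u +i* v].
Proof.
move=> d0 Ek.
pose m := (Num.truncn (`|k| / delta)).+1.
have km : k <= m%:R * delta.
  apply: le_trans (ler_norm k) _; rewrite -ler_pdivrMr //.
  by apply: ltW; apply: truncnS_gt.
pose pt (p : nat * nat) : R[i] := (delta * (p.1%:R - m%:R)) +i* (delta * (p.2%:R - m%:R)).
(* A corner of a cell containing [z] differs from [z] by at most [delta] in each coordinate, hence
   by at most [2 * delta]. *)
pose near_E p := `[< exists2 mu, E mu & `|pt p - mu| <= (2 * delta)%:C >].
pose s := [seq p <- [seq (a, b) | a <- iota 0 m.*2.+1, b <- iota 0 m.*2.+1] | near_E p].
pose lam j := pt (nth (0%N, 0%N) s j).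
have /choice [mu muP] : forall j, exists mu, (j < size s)%N ->
    E mu /\ `|lam j - mu| <= (2 * delta)%:C.
  move=> j; have [js|js] := ltnP j (size s); last by exists 0.
  have := mem_nth (0%N, 0%N) js; rewrite mem_filter => /andP[/asboolP [mu Emu h] _].
  by exists mu.
exists (size s), lam, mu; split=> // z Ez.
(* The strict bound on [a] keeps the opposite corner [a.+1] among the indices up to [m.*2]. *)
have index_le (t : R) : `|t| <= k -> exists2 a : nat, (a < m.*2)%N &
    delta * (a%:R - m%:R) <= t <= delta * (a%:R - m%:R) + delta.
  rewrite ler_norml => /andP[t1 t2].
  have t0 : 0 <= t / delta + m%:R.
    have : - m%:R <= t / delta by rewrite ler_pdivlMr // mulNr; lra.
    by lra.
  have ta : (Num.truncn (t / delta + m%:R))%:R <= t / delta + m%:R by rewrite truncn_le t0.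
  have tb : t / delta + m%:R < (Num.truncn (t / delta + m%:R)).+1%:R by exact: truncnS_gt.
  set a := Num.truncn _ in ta tb.
  have tE : t = delta * (t / delta) by rewrite mulrC divfK // gt_eqF.
  have tk : t / delta < m%:R.
    rewrite ltr_pdivrMr //; apply: le_lt_trans t2 _; apply: le_lt_trans (ler_norm k) _.
    by rewrite -ltr_pdivrMr //; apply: truncnS_gt.
  exists a.
    by rewrite -(ltr_nat R) -addnn natrD; lra.
  rewrite -natr1 in tb; move: ta tb tE; set w := t / delta => ta tb tE.
  by apply/andP; split; nra.
have [zr zi] := Ek z Ez.
have [a am az] := index_le _ zr; have [b bm bz] := index_le _ zi.
exists (delta * (a%:R - m%:R)), (delta * (b%:R - m%:R)); split=> // u v uin vin.
have [a' a'm uE] : exists2 a', (a' < m.*2.+1)%N & u = delta * (a'%:R - m%:R).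
  move: uin; rewrite !inE => /orP[/eqP ->|/eqP ->]; first by exists a => //; apply: ltnW.
  by exists a.+1 => //; rewrite -natr1; ring.
have [b' b'm vE] : exists2 b', (b' < m.*2.+1)%N & v = delta * (b'%:R - m%:R).
  move: vin; rewrite !inE => /orP[/eqP ->|/eqP ->]; first by exists b => //; apply: ltnW.
  by exists b.+1 => //; rewrite -natr1; ring.
have dist w c t : w \in [:: c; c + delta] -> c <= t <= c + delta -> `|w - t| <= delta.
  by rewrite !inE ler_norml => /orP[] /eqP -> /andP[? ?]; apply/andP; split; lra.
have ps : (a', b') \in s.
  rewrite mem_filter; apply/andP; split.
    apply/asboolP; exists z => //; apply: le_trans (norm_le_ReIm _) _.
    rewrite lecR !raddfB /= -uE -vE.
    by have := dist _ _ _ uin az; have := dist _ _ _ vin bz; lra.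
  by apply/allpairsP; exists (a', b'); split; rewrite ?mem_iota.
exists (index (a', b') s); first by rewrite index_mem.
by rewrite /lam nth_index // /pt /= -uE -vE.
Qed.

End FiniteGrid.

(** * Diagonal operators over a finite orthonormal family *)

Section DiagonalOperator.
Context (R : realType) (H : lmodType R[i]).
Context (q : H -> H -> R[i]) (qP : semi_inner_product q).
Local Notation sq := (sqnorm q).
Context (n : nat) (e : nat -> H) (en : orthonormal_upto q n e).

Lemma sip_sum_orthonormal (a : nat -> R[i]) j : (j < n)%N ->
  q (\sum_(i < n) a i *: e i) (e j) = a j.
Proof.
move=> jn; rewrite (sip_suml qP) (bigD1 (Ordinal jn)) //= (sipZl qP) en // eqxx mulr1.
rewrite big1 ?addr0 // => i ij; rewrite (sipZl qP) en //.
by move: ij; rewrite -val_eqE /= => /negPf ->; rewrite mulr0.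
Qed.

Lemma sip_sum2_orthonormal (a b : nat -> R[i]) :
  q (\sum_(i < n) a i *: e i) (\sum_(i < n) b i *: e i) = \sum_(i < n) a i * (b i)^*.
Proof.
rewrite (sip_sumr qP); apply: eq_bigr => i _.
by rewrite (sipZr qP) sip_sum_orthonormal // mulrC.
Qed.

Lemma bessel x : \sum_(i < n) `|q x (e i)| ^+ 2 <= q x x.
Proof.
pose p := \sum_(i < n) q x (e i) *: e i.
have E1 : q x p = \sum_(i < n) `|q x (e i)| ^+ 2.
  by rewrite (sip_sumr qP); apply: eq_bigr => i _; rewrite (sipZr qP) mulrC -normCK.
have E2 : q p p = \sum_(i < n) `|q x (e i)| ^+ 2.
  rewrite (sip_sum2_orthonormal (fun i => q x (e i)) (fun i => q x (e i))).
  by apply: eq_bigr => i _; rewrite -normCK.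
have E3 : q p x = \sum_(i < n) `|q x (e i)| ^+ 2.
  rewrite (sip_suml qP); apply: eq_bigr => i _.
  by rewrite (sipZl qP) (sipC qP x) -normCK.
have := sip_ge0 qP (x - p).
have -> : q (x - p) (x - p) = q x x - \sum_(i < n) `|q x (e i)| ^+ 2.
  rewrite (sipDl qP) !(sipDr qP) !(sipNl qP) !(sipNr qP) E1 E2 E3; ring.
by rewrite subr_ge0.
Qed.

Context (c : nat -> R[i]) (N : H -> H).
Context (NE : forall x, N x = \sum_(i < n) (c i * q x (e i)) *: e i).

Lemma diag_coord x j : (j < n)%N -> q (N x) (e j) = c j * q x (e j).
Proof. by move=> jn; rewrite NE (sip_sum_orthonormal (fun i => c i * q x (e i))). Qed.

Lemma diag_sqnorm_le (eta : R) : 0 <= eta ->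
  (forall j, (j < n)%N -> `|c j| <= eta%:C) -> forall x, sq (N x) <= eta ^+ 2 * sq x.
Proof.
move=> eta0 ceta x; rewrite -lecR -(sip_sqnorm qP) NE.
rewrite (sip_sum2_orthonormal (fun i => c i * q x (e i)) (fun i => c i * q x (e i))).
rewrite [(_ * sq x)%:C]rmorphM /= -(sip_sqnorm qP).
apply: le_trans (_ : (eta ^+ 2)%:C * \sum_(i < n) `|q x (e i)| ^+ 2 <= _); last first.
  by rewrite ler_wpM2l ?bessel // -(rmorph0 (real_complex R)) lecR sqr_ge0.
rewrite mulr_sumr; apply: ler_sum => i _; rewrite -normCK normrM exprMn.
rewrite ler_wpM2r ?exprn_ge0 // rmorphXn ler_pXn2r ?nnegrE ?ceta //.
by rewrite -(rmorph0 (real_complex R)) lecR.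
Qed.

Lemma diag_quad x : q (N x) x = \sum_(i < n) c i * q x (e i) * q (e i) x.
Proof. by rewrite NE (sip_suml qP); apply: eq_bigr => i _; rewrite (sipZl qP). Qed.

(** The form of [N] is a finite sum of products of coefficients [q x (e i)] and [q (e i) x], all
    tending to 0 along an essential net. *)
Lemma ess_num_range_diag (T : H -> H) mu :
  ess_num_range q (T \+ N) mu -> ess_num_range q T mu.
Proof.
move=> [F PF [Ff F1 FB]]; exists F; [exact: PF | split; [exact: Ff | exact: F1 | ]].
have FF : Filter F by exact: filter_filter.
have Fr f : tends F (fun x => q f x) 0.
  have := tends_conj FF (Ff f); rewrite rmorph0.
  by under eq_fun do rewrite -(sipC qP).
have FN : tends F (fun x => q (N x) x) 0.
  under eq_fun do rewrite diag_quad.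
  apply: (@tends_sum0 _ _ 'I_n _ FF _ (fun i x => c i * q x (e i) * q (e i) x)) => i.
  have := tendsM FF (tendsM FF (tends_cst FF (c i)) (Ff (e i))) (Fr (e i)).
  by rewrite mulr0.
have := tendsB FF FB FN; rewrite subr0.
have -> : (fun x => q ((T \+ N) x) x - q (N x) x) = (fun x => q (T x) x).
  by apply/funext => x /=; rewrite (sipDl qP) addrK.
exact.
Qed.

End DiagonalOperator.

(** * Finite-rank operators on the Hilbert space *)

Section FiniteRank.
Context (R : realType) (H : completeNormedModType R[i]).
Context (dot : {dot H for Num.conj}).

(** One shape for three operators of the main proof: the perturbation, its [A]-adjoint (conjugated
    coefficients) and its Hilbert adjoint (also [f] and [g] exchanged). *)
Definition finite_rank (n : nat) (c : nat -> R[i]) (f g : nat -> H) (x : H) : H :=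
  \sum_(i < n) (c i * dot x (f i)) *: g i.

Lemma finite_rank_is_linear n c f g : linear (finite_rank n c f g).
Proof.
move=> a x y; rewrite /finite_rank scaler_sumr -big_split /=; apply: eq_bigr => i _.
by rewrite linearDl linearZl_LR /= scalerA -scalerDl; congr (_ *: _); ring.
Qed.

HB.instance Definition _ n c f g :=
  GRing.isLinear.Build R[i] H H *:%R (finite_rank n c f g) (finite_rank_is_linear n c f g).

Context (norm_dot : forall x : H, `|x| ^+ 2 = dot x x).

Lemma dot_semi_inner_product : semi_inner_product dot.
Proof.
split=> [x y z|a x y|x y|x]; rewrite ?linearDl ?linearZl_LR //.
by rewrite hermC expr0 mul1r.
Qed.
Let dP := dot_semi_inner_product.

Lemma norm_sqnorm x : `|x| ^+ 2 = (sqnorm dot x)%:C.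
Proof. by rewrite norm_dot (sip_sqnorm dP). Qed.

Lemma dot_norm_le x y : `|dot x y| <= `|x| * `|y|.
Proof.
rewrite -(@ler_pXn2r _ 2) ?nnegrE ?mulr_ge0 //.
apply: le_trans (sip_cauchy_schwarz dP x y) _.
by rewrite exprMn !norm_sqnorm -rmorphM.
Qed.

Lemma finite_rank_bounded n c f g : bounded_operator (finite_rank n c f g).
Proof.
pose C := \sum_(i < n) `|c i| * `|f i| * `|g i|.
have C0 : 0 <= C by apply: sumr_ge0 => i _; rewrite !mulr_ge0.
exists (complex.Re C) => x; rewrite RRe_real ?ger0_real //.
apply: le_trans (ler_norm_sum _ _ _) _; rewrite mulr_suml.
apply: ler_sum => i _; rewrite normrZ normrM.
have -> : `|c i| * `|f i| * `|g i| * `|x| = `|c i| * (`|x| * `|f i|) * `|g i| by ring.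
by rewrite ler_wpM2r // ler_wpM2l // dot_norm_le.
Qed.

Lemma finite_rank_adjoint n c f g :
  is_adjoint dot (finite_rank n c f g) (finite_rank n (fun i => (c i)^*) g f).
Proof.
split; first exact: finite_rank_bounded.
move=> x y; rewrite /finite_rank (sip_suml dP) (sip_sumr dP).
apply: eq_bigr => i _; rewrite (sipZl dP) (sipZr dP) [(_ * dot y _)^*]rmorphM /= conjCK.
by rewrite -(sipC dP); ring.
Qed.

Lemma closed_complete_for (M : set H) : closed M -> complete_for dot M.
Proof.
move=> Mcl u uM uc.
have sq_lt (x : H) (e : R) : 0 < e -> sqnorm dot x < e ^+ 2 -> `|x| < e%:C.
  move=> e0 h; rewrite -(@ltr_pXn2r _ 2) ?nnegrE ?(ltW e0) //.
    by rewrite norm_sqnorm -rmorphXn ltcR.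
  by rewrite -(rmorph0 (real_complex R)) lecR ltW.
have lt_sq (x : H) (e : R) : 0 < e -> `|x| < e%:C -> sqnorm dot x < e ^+ 2.
  move=> e0 h; rewrite -ltcR -norm_sqnorm rmorphXn ltr_pXn2r ?nnegrE //.
  by rewrite -(rmorph0 (real_complex R)) lecR ltW.
have posE (e : R[i]) : 0 < e -> exists2 r : R, 0 < r & e = r%:C.
  move=> e0; have eE : e = (complex.Re e)%:C by rewrite RRe_real // gtr0_real.
  by exists (complex.Re e) => //; rewrite -ltcR -eE.
have cu : cauchy (u @ \oo).
  apply: cauchy_exP => _ /posE [e e0 ->].
  have [|n0 n0P] := uc (e ^+ 2 / 2); first by rewrite divr_gt0 ?exprn_gt0.
  exists (u n0); exists n0 => // n /= n0n.
  rewrite -ball_normE /=; apply: sq_lt => //; apply: le_lt_trans (n0P _ _ _ n0n) _ => //.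
  by rewrite gtr_pMr ?exprn_gt0 // invf_lt1 ?ltr1n.
have uPF : ProperFilter (u @ \oo) by exact: fmap_proper_filter.
have ul := @cauchy_cvg H (u @ \oo) uPF cu; set l := lim _ in ul.
exists l.
  by apply: (closed_cvg M Mcl _ l ul); apply: nearW.
move=> e e0; have s0 : 0 < Num.sqrt e by rewrite sqrtr_gt0.
have [|n0 _ n0P] := @cvgr_dist_lt _ _ _ _ _ _ _ ul (Num.sqrt e)%:C.
  by rewrite -(rmorph0 (real_complex R)) ltcR.
exists n0 => n n0n; have := n0P n n0n; rewrite /= distrC => /(lt_sq _ _ s0).
by rewrite sqr_sqrtr ?(ltW e0) // => /ltW.
Qed.

(** * The semi-inner product induced by a positive operator *)

Section WeightedForm.
Context (A : {linear H -> H}) (A_positive : positive_operator dot A).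
Local Notation q := (dotA dot A).

(** Hermitian symmetry comes by polarisation: the quadratic form of [A] is real at [x], [y], [x + y]
    and [x + 'i *: y]. *)
Lemma dotA_semi_inner_product : semi_inner_product q.
Proof.
have qDl x y z : q (x + y) z = q x z + q y z by rewrite /dotA linearD (sipDl dP).
have qZl a x y : q (a *: x) y = a * q x y by rewrite /dotA linearZ (sipZl dP).
have AD x y : A (x + y) = A x + A y by exact: linearD.
have AZ a x : A (a *: x) = a *: A x by exact: linearZ.
split=> // x y.
have := A_positive (x + y); have := A_positive (x + 'i *: y).
have := A_positive x; have := A_positive y.
rewrite !AD !AZ !(sipDl dP) !(sipDr dP) !(sipZl dP) !(sipZr dP).
rewrite /dotA; move: (dot (A x) x) (dot (A x) y) (dot (A y) x) (dot (A y) y).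
move=> [a1 a2] [b1 b2] [c1 c2] [d1 d2].
rewrite /Num.conj !lecE /=.
move=> /andP[/eqP h1 _] /andP[/eqP h2 _] /andP[/eqP h3 _] /andP[/eqP h4 _].
by congr (_ +i* _); lra.
Qed.
Let qP := dotA_semi_inner_product.

Lemma dotA_dot x y : dot x (A y) = q x y.
Proof. by rewrite (sipC dP) (sipC qP). Qed.

Context (A_bounded : bounded_operator A) (A_closed_range : closed (range A)).

(** Since [|A x|^2 = <x, A x>_A], Cauchy-Schwarz bounds [|A x|^4] by [|x|_A^2 |A x|_A^2], and
    [|A x|_A^2 <= k |A x|^2] by boundedness. *)
Lemma sqnorm_image_le : exists2 k : R, 0 < k &
  forall x, sqnorm dot (A x) <= k * sqnorm q x.
Proof.
case: A_bounded => k0 k0P; pose k := `|k0| + 1.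
have k1 : 0 < k by rewrite ltr_wpDl.
have kP x : sqnorm dot (A x) <= k ^+ 2 * sqnorm dot x.
  have kE : (k ^+ 2 * sqnorm dot x)%:C = (k%:C * `|x|) ^+ 2.
    by rewrite exprMn norm_sqnorm rmorphM rmorphXn.
  rewrite -lecR kE -norm_sqnorm ler_pXn2r ?nnegrE ?mulr_ge0 //.
    apply: le_trans (k0P x) _; rewrite ler_wpM2r // lecR.
    by rewrite /k; have := ler_norm k0; lra.
  by rewrite -(rmorph0 (real_complex R)) lecR ltW.
exists k => // x; set D := sqnorm dot (A x).
have D0 : 0 <= D by exact: sqnorm_ge0.
have h1 : D ^+ 2 <= sqnorm q x * sqnorm q (A x) by have := sip_Re_cauchy_schwarz qP x (A x).
have h2 : sqnorm q (A x) <= k * D.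
  have := sip_Re_cauchy_schwarz dP (A (A x)) (A x); rewrite -/D.
  have := kP (A x); rewrite -/D => h3 h4.
  have s0 : 0 <= sqnorm q (A x) by exact: sqnorm_ge0.
  rewrite -(@ler_pXn2r _ 2) ?nnegrE ?mulr_ge0 ?(ltW k1) //.
  apply: le_trans h4 _; rewrite exprMn [D ^+ 2]expr2 mulrA ler_wpM2r //.
have q0 : 0 <= sqnorm q x by exact: sqnorm_ge0.
have [->|Dn0] := eqVneq D 0; first by rewrite mulr_ge0 // ltW.
have Dp : 0 < D by rewrite lt0r Dn0.
rewrite -(ler_pM2r Dp) -expr2; apply: le_trans h1 _.
by rewrite [k * _]mulrC -mulrA ler_wpM2l.
Qed.

(* The images [A u_n] converge to some [A x]; then
   [|u_n - x|_A^2 = <A (u_n - x), u_n - u_m> + <u_n - x, A (u_m - x)>]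
   is small for [n] and [m] large. *)
Lemma dotA_complete : complete_for q setT.
Proof.
move=> u _ uc; have [k k0 kP] := sqnorm_image_le.
have [||_ [x _ <-] xP] := closed_complete_for A_closed_range (u := fun n => A (u n)).
- by move=> n; exists (u n).
- move=> e e0; have [|n0 n0P] := uc (e / k); first by rewrite divr_gt0.
  exists n0 => n m nn nm; rewrite -linearB; apply: le_trans (kP _) _.
  by rewrite mulrC -ler_pdivlMr // n0P.
exists x => // e e0.
have [n0 n0P] := uc (e / 4) ltac:(by rewrite divr_gt0).
exists n0 => n nn; pose w m := u m - x.
have wE m : sqnorm q (w n) = complex.Re (q (w n) (u n - u m)) + complex.Re (dot (w n) (A (w m))).
  rewrite dotA_dot -raddfD -(sipDr qP) /sqnorm; congr (complex.Re (q _ _)).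
  by rewrite /w addrA subrK.
have w0 : 0 <= sqnorm q (w n) by exact: sqnorm_ge0.
have d0 : 0 <= sqnorm dot (w n) by exact: sqnorm_ge0.
rewrite -/(w n); set Q := sqnorm q (w n) in wE w0 *; set D := sqnorm dot (w n) in d0.
rewrite leNgt; apply/negP => eQ.
(* Here [n], hence [D], is already fixed; the bound makes [D] times the squared norm of [A (w m)] at
   most [(e / 4) ^+ 2]. *)
have [|m0 m0P] := xP ((e / 4) ^+ 2 / (D + 1)).
  by rewrite divr_gt0 ?exprn_gt0 ?divr_gt0 // ltr_wpDl.
pose m := maxn n0 m0.
have := wE m; set a := complex.Re _; set b := complex.Re _ => QE.
have a2 : a ^+ 2 <= Q * (e / 4).
  apply: le_trans (sip_Re_cauchy_schwarz qP _ _) _; rewrite ler_wpM2l //.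
  by apply: n0P => //; rewrite leq_maxl.
have b2 : b ^+ 2 <= (e / 4) ^+ 2.
  apply: le_trans (sip_Re_cauchy_schwarz dP _ _) _; rewrite -/D.
  have := m0P m (leq_maxr _ _); rewrite -linearB -/(w m).
  rewrite ler_pdivlMr; last by lra.
  have := sqnorm_ge0 dP (A (w m)); nra.
have b1 : b <= e / 4.
  apply: le_trans (ler_norm b) _.
  by rewrite -(@ler_pXn2r _ 2) ?nnegrE ?divr_ge0 ?(ltW e0) // real_normK ?num_real.
(* If [e < Q], then [a < Q / 2] and [b < Q / 4], contradicting [Q = a + b]. *)
by nra.
Qed.

(* As [A] kills the orthogonal complement of its range, every vector agrees with
   one of the range up to a null vector of the semi-norm. *)
Lemma range_representative x : exists2 r, range A r & sqnorm q (x - r) = 0.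
Proof.
have [|||||||r Ar rP] := @riesz_on _ _ _ dP (range A) (dot x) (sqnorm dot x).
- by exists 0 => //; rewrite linear0.
- by move=> _ _ [u _ <-] [v _ <-]; exists (u + v) => //; rewrite linearD.
- by move=> a _ [u _ <-]; exists (a *: u) => //; rewrite linearZ.
- by move=> u v; rewrite (sipDr dP).
- by move=> a u; rewrite (sipZr dP).
- by move=> v _; have := sqnorm_ge0 dP (x - v); rewrite (sqnormB dP); lra.
- exact: closed_complete_for.
exists r => //; rewrite /sqnorm -dotA_dot (sipDl dP) (sipNl dP).
by rewrite rP ?subrr //; exists (x - r).
Qed.

End WeightedForm.
End FiniteRank.

(** * Construction of the perturbation and verification of its properties *)

Theorem theorem4p6 (R : realType) (H : completeNormedModType R[i])
  (dot : {dot H for Num.conj})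
  (norm_dot : forall x : H, `|x| ^+ 2 = dot x x)
  (H_separable : separable H)
  (H_infdim : ~ finite_dimensional [set: H])
  (A : {linear H -> H})
  (A_bounded : bounded_operator A)
  (A_positive : positive_operator dot A)
  (A_neq0 : exists x : H, A x != 0)
  (A_closed_range : closed (range A))
  (T : {linear H -> H}) (T_B : B_Ahalf dot A T)
  (eps : R) (eps_gt0 : 0 < eps) :
  exists N : {linear H -> H},
    [/\ A_normal dot A N,
        (opnormA dot A N < eps%:E)%E,
        finite_dimensional (range (A \o N)) &
        closure (num_rangeA dot A (T \+ N)) = num_rangeA dot A (T \+ N)].
Proof.
have dP := dot_semi_inner_product dot.
have qP := dotA_semi_inner_product A_positive.
have q_complete := dotA_complete norm_dot A_positive A_bounded A_closed_range.
set q := dotA dot A in qP q_complete.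
have dq x y : dot x (A y) = q x y by exact: dotA_dot.
have normAE x : normA dot A x = Num.sqrt (sqnorm q x) by [].
case: T_B => _ [c c0 Tc].
have Tq x : sqnorm q (T x) <= c ^+ 2 * sqnorm q x.
  have := Tc x; rewrite !normAE -(@ler_pXn2r _ 2) ?nnegrE ?mulr_ge0 ?sqrtr_ge0 ?(ltW c0) //.
  by rewrite exprMn !sqr_sqrtr ?sqnorm_ge0.
(* The coefficients of [N] are at most [2 * delta] (grid) plus [delta] (choice of [e j]), that is
   [eps / 2]. *)
pose delta := eps / 6; have delta0 : 0 < delta by rewrite divr_gt0.
have [k kP] := ess_num_range_bounded qP Tq q_complete.
have [n [lam [mu [lamP cover]]]] := grid_cover delta0 kP.
have [e [eA en emu]] := ess_num_range_family qP Tq q_complete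
  (range_representative norm_dot A_positive A_closed_range) delta0
  (fun j jn => proj1 (lamP j jn)).
pose a j := lam j - q (T (e j)) (e j).
pose eta := 3 * delta; have eta0 : 0 <= eta by rewrite mulr_ge0 // ltW.
have a_le j : (j < n)%N -> `|a j| <= eta%:C.
  move=> jn; have [_ h1] := lamP j jn; have h2 := emu j jn.
  have -> : a j = (lam j - mu j) - (q (T (e j)) (e j) - mu j) by rewrite /a; ring.
  apply: le_trans (ler_normB _ _) _.
  have -> : eta%:C = (2 * delta)%:C + delta%:C by rewrite -rmorphD /eta; congr (_%:C); ring.
  by rewrite lerD // ltW.
(* As [dot x (A (e i)) = q x (e i)], both [N] and [X] are diagonal over the [e i]; [X] is the
   [A]-adjoint of [N] and [S] its Hilbert adjoint. *)
pose N : {linear H -> H} := finite_rank dot n a (fun i => A (e i)) e.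
pose X : {linear H -> H} := finite_rank dot n (fun i => (a i)^*) (fun i => A (e i)) e.
pose S : {linear H -> H} := finite_rank dot n (fun i => (a i)^*) e (fun i => A (e i)).
have NE x : N x = \sum_(i < n) (a i * q x (e i)) *: e i.
  by apply: eq_bigr => i _; rewrite dq.
have XE x : X x = \sum_(i < n) ((a i)^* * q x (e i)) *: e i.
  by apply: eq_bigr => i _; rewrite dq.
have NS : is_adjoint dot N S by exact: finite_rank_adjoint.
have AXS x : A (X x) = S (A x).
  by rewrite XE linear_sum; apply: eq_bigr => i _; rewrite linearZ.
have Xrange x : range A (X x).
  have /choice [w wP] : forall i, exists w, (i < n)%N -> A w = e i.
    move=> i; have [im|] := boolP (i < n)%N; last by exists 0.
    by have [w _ <-] := eA i im; exists w.
  exists (\sum_(i < n) ((a i)^* * q x (e i)) *: w i) => //.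
  by rewrite XE linear_sum; apply: eq_bigr => i _; rewrite linearZ /= wP.
have Nq x : sqnorm q (N x) <= eta ^+ 2 * sqnorm q x by exact: (diag_sqnorm_le qP en NE).
exists N; split.
- split.
    split; first exact: finite_rank_bounded.
    by exists S => // _ [x _ <-] /=; rewrite -AXS; exists (X x).
  exists X.
    split; first exact: finite_rank_bounded.
    split; first by exists S.
    by move=> _ [x _ <-]; apply: subset_closure; exact: Xrange.
  (* Both products are diagonal with coefficients [a i * (a i)^*]. *)
  move=> x; congr (A _); rewrite XE [RHS]NE; apply: eq_bigr => i _.
  rewrite (diag_coord qP en NE) // (diag_coord qP en (c := fun i => (a i)^*) XE) //.
  by congr (_ *: _); ring.
- apply: (@le_lt_trans _ _ eta%:E); last first.
    by rewrite lte_fin /eta /delta; lra.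
  apply: ge_ereal_sup => _ [x _ <-]; rewrite lee_fin !normAE.
  have h : Num.sqrt (sqnorm q (N x)) <= eta * Num.sqrt (sqnorm q x).
    rewrite -{1}(ger0_norm eta0) -sqrtr_sqr -sqrtrM ?sqr_ge0 //.
    exact: ler_wsqrtr.
  (* A quotient with zero denominator takes the default value 0. *)
  have [->|s0] := eqVneq (Num.sqrt (sqnorm q x)) 0; first by rewrite invr0 mulr0.
  by rewrite ler_pdivrMr // lt0r s0 sqrtr_ge0.
- exists n, (fun i => A (e i)) => _ [x _ <-].
  exists (fun i : 'I_n => a i * q x (e i)).
  by rewrite /= NE linear_sum; apply: eq_bigr => i _; rewrite linearZ.
have Wnum : num_rangeA dot A (T \+ N) = num_range q (T \+ N).
  apply/seteqP; split=> _ [x x1 <-]; exists x => //=.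
    move: x1; rewrite /= normAE => x1.
    by rewrite -[sqnorm q x]sqr_sqrtr ?sqnorm_ge0 // x1 expr1n.
  by rewrite /= normAE x1 sqrtr1.
(* The parallelogram law with the term of [T x - N x] dropped. *)
have Bq x : sqnorm q ((T \+ N) x) <= (2 * c ^+ 2 + 2 * eta ^+ 2) * sqnorm q x.
  have := Tq x; have := Nq x; have := sqnorm_ge0 qP (T x - N x).
  rewrite (sqnormB qP) /= => h1 h2 h3.
  have -> : T x + N x = T x + 1%:C *: N x by rewrite scale1r.
  by rewrite (sqnormD qP); lra.
have Wlam j : (j < n)%N -> num_range q (T \+ N) (lam j).
  move=> jn; exists (e j); first by rewrite /= /sqnorm en // eqxx.
  rewrite /= (sipDl qP) (diag_coord qP en NE) // en // eqxx mulr1 /a.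
  by rewrite addrC subrK.
rewrite Wnum; apply/seteqP; split; last exact: subset_closure.
move=> z zcl; apply: (num_range_closed qP Bq q_complete).
  (* An essential value of [T + N] is one of [T], so it lies in a cell whose four corners are values
     attained at some [e j]. *)
  move=> m /(ess_num_range_diag qP NE) /cover [x [y [mx my corner]]].
  have W u v : u \in [:: x; x + delta] -> v \in [:: y; y + delta] ->
      num_range q (T \+ N) (u +i* v).
    by move=> ux vy; have [j jn <-] := corner u v ux vy; exact: Wlam.
  by apply: (num_range_square qP Bq _ _ _ _ mx my); apply: W; rewrite !inE eqxx ?orbT.
move=> r r0.
have [|w [Ww wz]] := zcl (ball (z : R[i]^o) r%:C).
  by apply: nbhsx_ballx; rewrite -(rmorph0 (real_complex R)) ltcR.
by exists w => //; move: wz; rewrite -ball_normE /= distrC.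
Qed.
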